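(* Let $R$ be a commutative ring with unity, let $G$ be a finite group of order $n$, and let $\sigma,\tau$ be $R$-algebra endomorphisms of $RG$ which are $R$-linear extensions of group endomorphisms of $G$. Let $C_1,\dots,C_r$ be all the distinct $(\sigma,\tau)$-conjugacy classes of $G$, with representatives $x_1,\dots,x_r$ respectively. Then the rank of the $R$-module $\mathrm{Inn}_{(\sigma,\tau)}(RG)$ is $n-r$. Furthermore, if $s$ is a positive integer such that $|C_i|=1$ for all $i\in\{1,\dots,s\}$ and $|C_i|\ge 2$ for all $i\in\{s+1,\dots,r\}$, then the set $$\mathcal{B}_0=\left\{D_g\;\middle|\; g\in\bigcup_{i=s+1}^r(C_i\setminus\{x_i\})\right\}$$ is an $R$-basis of $\mathrm{Inn}_{(\sigma,\tau)}(RG)$.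
   Context: For $x\in G$, the $(\sigma,\tau)$-conjugacy class of $x$ in $G$ is $\{\sigma(g)x\tau(g)^{-1}\mid g\in G\}$; these classes partition $G$. For $\beta\in RG$, $D_\beta: RG\to RG$ denotes the inner $(\sigma,\tau)$-derivation $D_\beta(\alpha)=\beta\tau(\alpha)-\sigma(\alpha)\beta$. $\mathrm{Inn}_{(\sigma,\tau)}(RG)=\{D_\beta\mid\beta\in RG\}$, an $R$-module under pointwise operations. *)

(* Defs.v *)
From HB Require Import structures.
From mathcomp Require Import all_boot all_order all_fingroup all_algebra.
From mathcomp Require Import finmap.
From mathcomp Require Import all_classical.

Set Implicit Arguments.
Unset Strict Implicit.
Unset Printing Implicit Defensive.

Import GRing.Theory.

Local Open Scope classical_set_scope.
Local Open Scope ring_scope.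

(* An alias, because {ffun G -> R} itself carries the pointwise product; R^o
   makes R a module over itself, so that scaling is pointwise. *)
Definition group_ring (R : comNzRingType) (G : finGroupType) : Type :=
  {ffun G -> R^o}.

Section GroupRing.
Variables (R : comNzRingType) (G : finGroupType).
Local Notation RG := (group_ring R G).

HB.instance Definition _ := GRing.Lmodule.copy RG {ffun G -> R^o}.

Definition gring_elt (g : G) : RG := [ffun h => (h == g)%:R].

Definition gring_mul (a b : RG) : RG :=
  [ffun g => \sum_(h : G) a h * b (h^-1 * g)%g].

Fact gring_mulA : associative gring_mul.
Proof.
move=> a b c; apply/ffunP => g; rewrite !ffunE.
under eq_bigr do rewrite ffunE mulr_sumr.
under [RHS]eq_bigr do rewrite ffunE mulr_suml.
rewrite [RHS]exchange_big /=; apply: eq_bigr => h _.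
rewrite [RHS](reindex_inj (mulgI h)) /=; apply: eq_bigr => k _.
by rewrite mulKg invMg !mulgA mulrA.
Qed.

Fact gring_mul1 : left_id (gring_elt 1) gring_mul.
Proof.
move=> a; apply/ffunP => g; rewrite ffunE (bigD1 1%g) //= big1 ?addr0.
  by rewrite ffunE eqxx mul1r invg1 mul1g.
by move=> h /negPf h1; rewrite ffunE h1 mul0r.
Qed.

Fact gring_mulr1 : right_id (gring_elt 1) gring_mul.
Proof.
move=> a; apply/ffunP => g; rewrite ffunE (bigD1 g) //= big1 ?addr0.
  by rewrite ffunE mulVg eqxx mulr1.
by move=> h /negPf hg; rewrite ffunE -eq_mulVg1 hg mulr0.
Qed.

Fact gring_mulDl : left_distributive gring_mul +%R.
Proof.
move=> a b c; apply/ffunP => g; rewrite !ffunE -big_split /=.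
by apply: eq_bigr => h _; rewrite ffunE mulrDl.
Qed.

Fact gring_mulDr : right_distributive gring_mul +%R.
Proof.
move=> a b c; apply/ffunP => g; rewrite !ffunE -big_split /=.
by apply: eq_bigr => h _; rewrite ffunE mulrDr.
Qed.

Fact gring_oner_neq0 : gring_elt 1 != 0.
Proof.
by apply/eqP => /ffunP /(_ 1%g); rewrite !ffunE eqxx; apply/eqP/oner_neq0.
Qed.

HB.instance Definition _ := GRing.Zmodule_isNzRing.Build RG
  gring_mulA gring_mul1 gring_mulr1 gring_mulDl gring_mulDr gring_oner_neq0.

Fact gring_scalerAl (k : R) (a b : RG) : k *: (a * b) = (k *: a) * b.
Proof.
apply/ffunP => g; rewrite !ffunE scaler_sumr.
by apply: eq_bigr => h _; rewrite ffunE -scalerAl.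
Qed.

HB.instance Definition _ := GRing.Lmodule_isLalgebra.Build R RG gring_scalerAl.

Fact gring_scalerAr (k : R) (a b : RG) : k *: (a * b) = a * (k *: b).
Proof.
apply/ffunP => g; rewrite !ffunE scaler_sumr.
by apply: eq_bigr => h _; rewrite ffunE -scalerAr.
Qed.

HB.instance Definition _ := GRing.Lalgebra_isAlgebra.Build R RG gring_scalerAr.

End GroupRing.

Definition linear_extension (R : comNzRingType) (G : finGroupType)
    (f : {morphism [set: G]%SET >-> G})
    (sigma : {lrmorphism group_ring R G -> group_ring R G}) : Prop :=
  forall g : G, sigma (gring_elt R g) = gring_elt R (f g).

(* Here the twisting maps are the group endomorphisms underlying sigma, tau. *)
Definition twisted_class (G : finGroupType)
    (f h : {morphism [set: G]%SET >-> G})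
    (x : G) : {set G} := [set (f g * x * (h g)^-1)%g | g : G]%SET.

Definition twisted_classes (G : finGroupType)
    (f h : {morphism [set: G]%SET >-> G}) :
  {set {set G}} := [set twisted_class f h x | x : G]%SET.

Definition inner_derivation (R : comNzRingType) (G : finGroupType)
    (sigma tau : {lrmorphism group_ring R G -> group_ring R G})
    (beta : group_ring R G) : group_ring R G -> group_ring R G :=
  fun alpha => beta * tau alpha - sigma alpha * beta.

(* A subset of the R-module of all maps RG -> RG with pointwise operations. *)
Definition Inn (R : comNzRingType) (G : finGroupType)
    (sigma tau : {lrmorphism group_ring R G -> group_ring R G}) :
  set (group_ring R G -> group_ring R G) := range (inner_derivation sigma tau).

Section Bases.
Variables (R : comNzRingType) (V : lmodType R).

Definition lin_span (B : set V) : set V :=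
  [set v | exists (X : {fset V}) (a : V -> R),
    [set` X] `<=` B /\ v = \sum_(b <- X) a b *: b].

Definition lin_indep (B : set V) : Prop :=
  forall (X : {fset V}) (a : V -> R), [set` X] `<=` B ->
    \sum_(b <- X) a b *: b = 0 -> forall b, b \in X -> a b = 0.

(* B is a basis of the submodule M of V. *)
Definition is_basis (M B : set V) : Prop := lin_indep B /\ lin_span B = M.

(* M is free of rank k; k is unique since R is commutative and nonzero. *)
Definition has_rank (M : set V) (k : nat) : Prop :=
  exists B : set V, (B #= `I_k)%card /\ is_basis M B.

End Bases.

(* Inn is a submodule, so has_rank and is_basis are meaningful for it. *)
Lemma Inn_closed (R : comNzRingType) (G : finGroupType)
    (sigma tau : {lrmorphism group_ring R G -> group_ring R G}) :
  Inn sigma tau 0 /\ forall (k : R) d e, Inn sigma tau d -> Inn sigma tau e ->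
    Inn sigma tau (k *: d + e).
Proof.
split=> [|k d e [a _ <-] [b _ <-]].
  exists 0 => //; apply/funext => u.
  by rewrite /inner_derivation mul0r mulr0 subr0.
exists (k *: a + b) => //; apply/funext => u.
rewrite /inner_derivation mulrDl mulrDr -scalerAl -scalerAr.
by rewrite opprD addrACA -scalerBr.
Qed.

(* Main.v *)
Require Import Defs.
From HB Require Import structures.
From mathcomp Require Import all_boot all_order all_fingroup all_algebra.
From mathcomp Require Import finmap.
From mathcomp Require Import all_classical.

(** The map [beta |-> D_beta] is linear from [RG] onto [Inn], so [Inn] is [RG]
    modulo the kernel of that map.  Testing [D_beta] on group elements shows
    that [D_beta = 0] means [beta (f g * y * (h g)^-1) = beta y] for all [g]
    and [y] ([inner_derivation_eq0]): the kernel consists of the functions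
    constant on the twisted classes.

    Given one representative [x i] in each class, every function [beta] splits
    uniquely as a function constant on classes (with the values of [beta] at
    the representatives) plus a function vanishing at all representatives.  The
    latter functions are therefore a complement of the kernel, freely spanned
    by the group elements other than the [x i]; hence the [D_g], with [g] not a
    representative, form a basis of [Inn] ([nonrepresentatives_free] and
    [nonrepresentatives_span]).  There are [n - r] such [g].  Finally a
    singleton class consists of its representative alone, so the
    non-representatives all lie in the classes having at least two elements. *)

Set Implicit Arguments.
Unset Strict Implicit.
Unset Printing Implicit Defensive.

Import GRing.Theory.

Local Open Scope classical_set_scope.
Local Open Scope ring_scope.

(** * Bases given by finite families *)

Section FamilyBasis.
Variables (R : comNzRingType) (V : lmodType R) (I : finType).
Variables (S : {set I}) (v : I -> V).

Hypothesis v_free : forall c : I -> R, \sum_(i in S) c i *: v i = 0 ->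
  forall i, i \in S -> c i = 0.

(** A repeated vector [v i = v j] would give the relation with coefficient [1]
    at [i] and [-1] at [j]; this is where [1 != 0] in [R] matters. *)
Lemma free_family_inj : {in S &, injective v}.
Proof.
move=> i j iS jS vij; apply/eqP; apply: contraT => nij.
pose c k : R := (k == i)%:R - (k == j)%:R.
have sum_delta k : k \in S -> \sum_(l in S) (l == k)%:R *: v l = v k :> V.
  move=> kS; rewrite (bigD1 k) //= eqxx scale1r big1 ?addr0 // => l.
  by case/andP=> _ /negPf ->; rewrite scale0r.
have /v_free/(_ i iS) : \sum_(k in S) c k *: v k = 0.
  under eq_bigr do rewrite scalerBl.
  by rewrite sumrB !sum_delta // vij subrr.
by rewrite /c eqxx (negPf nij) subr0 => /eqP; rewrite oner_eq0.
Qed.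

(** Sums over a finite set of vectors of the family are sums over its
    indices: this is the passage from sets to families. *)
Lemma sum_fset_family (X : {fset V}) (a : V -> R) :
  [set` X] `<=` v @` [set` S] ->
  \sum_(b <- X) a b *: b =
  \sum_(i in S) (if v i \in X then a (v i) else 0) *: v i.
Proof.
move=> XS.
have XP : perm_eq X [seq v i | i <- enum [set i in S | v i \in X]%SET].
  apply: uniq_perm; first exact: fset_uniq.
    rewrite map_inj_in_uniq ?enum_uniq // => i j.
    rewrite !mem_enum !inE => /andP[iS _] /andP[jS _].
    exact: free_family_inj.
  move=> b; apply/idP/mapP => [bX|[i]].
    have [i iS vib] := XS _ bX.
    by exists i; rewrite // mem_enum inE vib bX andbT.
  by rewrite mem_enum inE => /andP[_ ?] ->.
rewrite (perm_big _ XP) /= big_map big_enum_cond /=.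
under eq_bigl do rewrite inE andbT.
rewrite big_mkcondr /=; apply: eq_bigr => i _.
by case: ifP => // _; rewrite scale0r.
Qed.

Variable M : set V.
Hypothesis v_in : forall c : I -> R, M (\sum_(i in S) c i *: v i).
Hypothesis v_span : forall m, M m -> exists c : I -> R,
  m = \sum_(i in S) c i *: v i.

Lemma family_is_basis : is_basis M (v @` [set` S]).
Proof.
split=> [X a XS|].
  rewrite sum_fset_family // => /v_free a0 b bX.
  have [i iS vib] := XS _ bX.
  by have := a0 i iS; rewrite vib bX.
apply/seteqP; split=> [m [X [a [XS ->]]]|m /v_span[c ->]].
  by rewrite sum_fset_family //; exact: v_in.
(* By injectivity the sum defining the coefficient of [v i] is just [c i]. *)
exists [fset v i | i in S]%fset, (fun b => \sum_(i in S | v i == b) c i).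
have XS : [set` [fset v i | i in S]%fset] `<=` v @` [set` S].
  by move=> b /= /imfsetP[i /= iS ->]; exists i.
split=> //; rewrite sum_fset_family //; apply: eq_bigr => i iS.
rewrite in_imfset // (big_pred1 i) // => j /=.
apply/andP/eqP => [[jS /eqP]|->]; last by rewrite iS eqxx.
exact: free_family_inj.
Qed.

Lemma family_has_rank : has_rank M #|S|.
Proof.
exists (v @` [set` S]); split; last exact: family_is_basis.
have -> : v @` [set` S] = [set` [fset v i | i in S]%fset].
  apply/seteqP; split=> [b [i iS <-]|b /imfsetP[i /= iS ->]]; last by exists i.
  exact: in_imfset.
apply/card_eq_fsetP; rewrite card_in_imfset /=; last exact: free_family_inj.
by rewrite cardE.
Qed.

End FamilyBasis.

(** * The kernel of the map sending an element to its inner derivation *)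

Section GroupRingElements.
Variables (R : comNzRingType) (G : finGroupType).
Implicit Types (a : group_ring R G) (g y : G).

Lemma gring_mul_eltr a g y : (a * gring_elt R g) y = a (y * g^-1)%g.
Proof.
rewrite ffunE (bigD1 (y * g^-1)%g) //= big1 ?addr0 => [|k kNy].
  by rewrite ffunE invMg invgK mulgKV eqxx mulr1.
rewrite ffunE; case: eqP => [kg|_]; last by rewrite mulr0.
by rewrite -kg invMg invgK mulKVg eqxx in kNy.
Qed.

Lemma gring_mul_eltl a g y : (gring_elt R g * a) y = a (g^-1 * y)%g.
Proof.
rewrite ffunE (bigD1 g) //= big1 ?addr0 => [|k kNg].
  by rewrite ffunE eqxx mul1r.
by rewrite ffunE (negPf kNg) mul0r.
Qed.

Lemma sum_gring_eltE (S : {set G}) (c : G -> R) y :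
  (\sum_(g in S) c g *: gring_elt R g : group_ring R G) y =
  if y \in S then c y else 0.
Proof.
rewrite sum_ffunE; under eq_bigr => g _ do rewrite !ffunE.
case: ifP => yS.
  rewrite (bigD1 y) //= big1 ?addr0 => [|g /andP[_ /negPf gy]].
    by rewrite eqxx; exact: mulr1.
  by rewrite eq_sym gy scaler0.
rewrite big1 // => g gS; case: eqP => [yg|_]; last exact: scaler0.
by rewrite yg gS in yS.
Qed.

Lemma gring_decomp a : a = \sum_(g in [set: G]%SET) a g *: gring_elt R g.
Proof. by apply/ffunP => y; rewrite sum_gring_eltE inE. Qed.

End GroupRingElements.

Section InnerDerivations.
Variables (R : comNzRingType) (G : finGroupType).
Variables (f h : {morphism [set: G]%SET >-> G}).
Variables (sigma tau : {lrmorphism group_ring R G -> group_ring R G}).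
Hypotheses (sigmaE : linear_extension f sigma) (tauE : linear_extension h tau).
Local Notation D := (inner_derivation sigma tau).

Lemma inner_derivation_is_linear : linear D.
Proof.
move=> k a b; apply/funext => u.
rewrite /inner_derivation mulrDl mulrDr -scalerAl -scalerAr.
by rewrite opprD addrACA -scalerBr.
Qed.

HB.instance Definition _ :=
  GRing.isLinear.Build R (group_ring R G) (group_ring R G -> group_ring R G)
    _ D inner_derivation_is_linear.

Lemma sum_inner_derivation (S : {set G}) (c : G -> R) :
  \sum_(g in S) c g *: D (gring_elt R g) =
  D (\sum_(g in S) c g *: gring_elt R g).
Proof. by rewrite linear_sum; apply: eq_bigr => g _; rewrite linearZ. Qed.

(** As [sigma] and [tau] are linear, [D_beta] vanishes as soon as it does on
    each group element [g], i.e. as soon as [beta * h g = f g * beta]; the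
    latter is compared coefficientwise. *)
Lemma inner_derivation_eq0 (beta : group_ring R G) :
  D beta = 0 <-> forall g y, beta (f g * y * (h g)^-1)%g = beta y.
Proof.
split=> [D0 g y|beta_const].
  have /eqP : D beta (gring_elt R g) = 0 by rewrite D0.
  rewrite /inner_derivation sigmaE tauE subr_eq0 => /eqP/ffunP/(_ (f g * y)%g).
  by rewrite gring_mul_eltr gring_mul_eltl mulKg.
apply/funext => u; rewrite /inner_derivation.
rewrite (gring_decomp u) !linear_sum mulr_sumr mulr_suml -sumrB big1 // => g _.
rewrite !linearZ /= sigmaE tauE -scalerAr -scalerAl -scalerBr.
rewrite (_ : _ - _ = 0) ?scaler0 //; apply/eqP; rewrite subr_eq0; apply/eqP.
apply/ffunP => y; rewrite gring_mul_eltr gring_mul_eltl.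
by rewrite -[RHS](beta_const g) mulKVg.
Qed.

(** * The basis attached to a system of class representatives *)

Lemma twisted_class_refl y : y \in twisted_class f h y.
Proof. by apply/imsetP; exists 1%g; rewrite // !morph1 invg1 mulg1 mul1g. Qed.

Lemma twisted_class_shift g y :
  twisted_class f h (f g * y * (h g)^-1)%g = twisted_class f h y.
Proof.
have sub k z :
    twisted_class f h (f k * z * (h k)^-1)%g \subset twisted_class f h z.
  apply/fintype.subsetP => _ /imsetP[l _ ->]; apply/imsetP; exists (l * k)%g => //.
  by rewrite !morphM ?inE // invMg !mulgA.
apply/eqP; rewrite finset.eqEsubset sub /=.
have {1}-> : y = (f g^-1 * (f g * y * (h g)^-1) * (h g^-1)^-1)%g.
  by rewrite !morphV ?inE // invgK !mulgA mulVg mul1g mulgKV.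
exact: sub.
Qed.

Variables (r : nat) (C : 'I_r -> {set G}) (x : 'I_r -> G).
Hypothesis C_inj : injective C.
Hypothesis C_all : [set C i | i : 'I_r]%SET = twisted_classes f h.
Hypothesis x_repr : forall i : 'I_r, x i \in C i.

Fact class_index_ex y : exists i, C i == twisted_class f h y.
Proof.
have : twisted_class f h y \in twisted_classes f h by apply/imsetP; exists y.
by rewrite -C_all => /imsetP[i _ ->]; exists i.
Qed.

Definition class_index y : 'I_r := xchoose (class_index_ex y).

Lemma class_indexE y : C (class_index y) = twisted_class f h y.
Proof. exact/eqP/(xchooseP (class_index_ex y)). Qed.

Lemma mem_class i y : (y \in C i) = (class_index y == i).
Proof.
apply/idP/eqP => [|<-]; last by rewrite class_indexE twisted_class_refl.
have : C i \in twisted_classes f h by rewrite -C_all; apply/imsetP; exists i.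
move=> /imsetP[z _ Ciz]; rewrite Ciz => /imsetP[g _ ->].
by apply: C_inj; rewrite class_indexE twisted_class_shift Ciz.
Qed.

Lemma class_index_shift g y :
  class_index (f g * y * (h g)^-1)%g = class_index y.
Proof. by apply: C_inj; rewrite !class_indexE twisted_class_shift. Qed.

Lemma class_index_repr i : class_index (x i) = i.
Proof. by apply/eqP; rewrite -mem_class. Qed.

Lemma const_on_class (beta : group_ring R G) y :
    (forall g z, beta (f g * z * (h g)^-1)%g = beta z) ->
  beta y = beta (x (class_index y)).
Proof.
move=> beta_const; have := x_repr (class_index y).
by rewrite class_indexE => /imsetP[g _ ->]; rewrite beta_const.
Qed.

Definition nonrepresentatives : {set G} := ~: [set x i | i : 'I_r]%SET.

Lemma mem_nonrepresentatives y :
  (y \in nonrepresentatives) = (y != x (class_index y)).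
Proof.
rewrite inE; congr (~~ _); apply/imsetP/eqP => [[i _ ->]|->].
  by rewrite class_index_repr.
by exists (class_index y).
Qed.

Lemma card_nonrepresentatives : #|nonrepresentatives| = (#|G| - r)%N.
Proof.
rewrite cardsCs finset.setCK card_imset ?card_ord ?cardsT //.
exact: can_inj class_index_repr.
Qed.

(** A combination of non-representatives vanishes at every [x i]; if it is also
    constant on classes, it is zero. *)
Lemma nonrepresentatives_free (c : G -> R) :
    \sum_(g in nonrepresentatives) c g *: D (gring_elt R g) = 0 ->
  forall g, g \in nonrepresentatives -> c g = 0.
Proof.
rewrite sum_inner_derivation => /inner_derivation_eq0 c_const g gN.
have := const_on_class g c_const; rewrite !sum_gring_eltE gN.
by rewrite mem_nonrepresentatives class_index_repr eqxx.
Qed.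

(** Subtracting from [beta] the function constant on classes that agrees with
    it at the representatives leaves [D_beta] unchanged and makes all
    coefficients at representatives vanish. *)
Lemma nonrepresentatives_span d : Inn sigma tau d -> exists c : G -> R,
  d = \sum_(g in nonrepresentatives) c g *: D (gring_elt R g).
Proof.
case=> beta _ <-; exists (fun g => beta g - beta (x (class_index g))).
rewrite sum_inner_derivation; apply/eqP; rewrite -subr_eq0 -linearB; apply/eqP.
apply/inner_derivation_eq0; set gamma := \sum_(g in _) _.
have gammaE y : (beta - gamma) y = beta (x (class_index y)).
  rewrite !ffunE sum_gring_eltE mem_nonrepresentatives.
  by case: eqP => [{1}->|_] /=; rewrite ?subr0 // subKr.
by move=> g y; rewrite !gammaE class_index_shift.
Qed.

Lemma nonrepresentatives_in (c : G -> R) :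
  Inn sigma tau (\sum_(g in nonrepresentatives) c g *: D (gring_elt R g)).
Proof. by rewrite sum_inner_derivation; apply: imageT. Qed.

(** In a singleton class the representative is the only element, so the classes
    with index below [s] contribute no non-representative. *)
Lemma nonrepresentatives_bigcup s :
    (forall i : 'I_r, (i < s)%N -> #|C i| = 1%N) ->
  nonrepresentatives = (\bigcup_(i < r | (s <= i)%N) (C i :\ x i))%SET.
Proof.
move=> C1; apply/setP => y; rewrite mem_nonrepresentatives.
apply/idP/bigcupP => [yN|[i _]]; last first.
  by rewrite !inE mem_class => /andP[yx /eqP->].
exists (class_index y); last by rewrite !inE yN mem_class eqxx.
rewrite leqNgt; apply: contra yN => /C1/eqP/cards1P[z Cz].
have := x_repr (class_index y); rewrite Cz inE => /eqP->.
by have := mem_class (class_index y) y; rewrite eqxx Cz inE => ->.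
Qed.

End InnerDerivations.

Theorem corollary4p15 (R : comNzRingType) (G : finGroupType) (n : nat)
    (hn : #|G| = n)
    (f h : {morphism [set: G]%SET >-> G})
    (sigma tau : {lrmorphism group_ring R G -> group_ring R G})
    (hsigma : linear_extension f sigma) (htau : linear_extension h tau)
    (r : nat) (C : 'I_r -> {set G}) (x : 'I_r -> G)
    (C_inj : injective C)
    (C_all : [set C i | i : 'I_r]%SET = twisted_classes f h)
    (x_repr : forall i : 'I_r, x i \in C i) :
  has_rank (Inn sigma tau) (n - r)%N /\
  (forall s : nat, (0 < s)%N -> (s <= r)%N ->
     (forall i : 'I_r, (i < s)%N -> #|C i| = 1%N) ->
     (forall i : 'I_r, (s <= i)%N -> (2 <= #|C i|)%N) ->
     is_basis (Inn sigma tau)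
       [set inner_derivation sigma tau (gring_elt R g)
         | g in [set` (\bigcup_(i < r | (s <= i)%N) (C i :\ x i))%SET]]).
Proof.
have free := nonrepresentatives_free hsigma htau C_inj C_all x_repr.
have span := nonrepresentatives_span hsigma htau C_inj C_all x_repr.
have inInn := nonrepresentatives_in sigma tau x.
split=> [|s _ _ C1 _].
  rewrite -hn -(card_nonrepresentatives C_inj C_all x_repr).
  exact: (family_has_rank free inInn span).
rewrite -(nonrepresentatives_bigcup C_inj C_all x_repr C1).
exact: (family_is_basis free inInn span).
Qed.
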